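(* Let $q$ be a prime power, $r\geqslant 2$ an integer, and $\mathcal{A}\subseteq \mathbb{F}_{q^r}^*$. Suppose $K(q,r)\geqslant 0$ is such that $\left|\sum_{\gamma\in\mathcal{A}}\chi(\gamma)\right|\leqslant K(q,r)$ for every divisor $d>1$ of $q^r-1$ and every multiplicative character $\chi$ of $\mathbb{F}_{q^r}^*$ of order $d$. Write $\mathrm{rad}(q^r-1)=k\prod_{i=1}^{s_1}p_i\prod_{j=1}^{s_2}l_j$ with $k$ a positive integer, $s_1,s_2\geqslant 0$ integers and $p_i,l_j$ primes. Let $\delta=1-\sum_{i=1}^{s_1}\frac{1}{p_i}$ and $\epsilon=\sum_{j=1}^{s_2}\frac{1}{l_j}$. Suppose $\delta\rho(k)>\epsilon$. If $$|\mathcal{A}|>\frac{\rho(k)W(k)(s_1+2\delta-1)+s_2-\delta\rho(k)-\epsilon}{\delta\rho(k)-\epsilon}\,K(q,r),$$ then $\mathcal{A}$ contains a primitive element of $\mathbb{F}_{q^r}$ (a generator of $\mathbb{F}_{q^r}^*$).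
   Context: $\rho(m)=\varphi(m)/m$ with $\varphi$ Euler's totient function; $W(m)=2^{\omega(m)}$ where $\omega(m)$ is the number of distinct prime divisors of $m$; $\mathrm{rad}(n)$ is the product of the distinct primes dividing $n$. *)

(* Defs.v *)
From HB Require Import structures.
From mathcomp Require Import all_boot all_order all_algebra all_fingroup all_solvable.
From mathcomp Require Import reals.
From mathcomp Require Import complex.
Set Implicit Arguments.
Unset Strict Implicit.
Unset Printing Implicit Defensive.
Import Order.TTheory GRing.Theory Num.Theory.

Local Open Scope ring_scope.

Definition prime_power (q : nat) : Prop :=
  exists p e : nat, [/\ prime p, (0 < e)%N & q = (p ^ e)%N].

Definition radn (n : nat) : nat := (\prod_(p <- primes n) p)%N.

(* Meaningful for 0 < m only. *)
Definition rho (R : realType) (m : nat) : R := (totient m)%:R / m%:R.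

Definition W (m : nat) : nat := (2 ^ size (primes m))%N.

(* [R[i]] is not a group, so homomorphisms to its unit group are not an
   instance of the library's group morphisms; the two equations force the
   values to be nonzero. *)
Definition mult_char (R : realType) (F : finFieldType)
    (chi : {unit F} -> R[i]) : Prop :=
  chi 1%g = 1 /\ {morph chi : x y / (x * y)%g >-> x * y}.

(* [d] is the order of [chi] in the group of characters under pointwise
   multiplication. *)
Definition char_order (R : realType) (F : finFieldType)
    (chi : {unit F} -> R[i]) (d : nat) : Prop :=
  [/\ (0 < d)%N,
      forall x, chi x ^+ d = 1
    & forall m : nat, (0 < m)%N -> (forall x, chi x ^+ m = 1) -> (d <= m)%N].

(* Main.v *)
(** Write e_p for the indicator of the p-th powers and u_k = prod_(p | k) (1 - e_p)
for that of the k-free elements.  If A has no primitive element, then on A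
  u_k - sum_i u_k e_(p_i) - sum_j e_(l_j) <= 0,
since the discrete logarithm of every element of A shares a prime with q^r - 1,
and this prime divides k or is some p_i or l_j.  Each e_p - 1/p is an average
of nontrivial characters of order p, with coefficients of total size 1 - 1/p.
Multiplying out, u_k - rho(k) has coefficients of total size rho(k) (W(k) - 1),
and u_k (e_p - 1/p) of total size rho(k) W(k) (1 - 1/p) when p does not divide k.
The left-hand side above is delta rho(k) - eps plus
  delta (u_k - rho(k)) - sum_i u_k (e_(p_i) - 1/p_i) - sum_j (e_(l_j) - 1/l_j),
so summing over A and bounding each character sum by K contradicts the
assumption on |A|. *)
Require Import Defs.
From HB Require Import structures.
From mathcomp Require Import all_boot all_order all_algebra all_fingroup all_solvable.
From mathcomp Require Import reals.
From mathcomp Require Import complex.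
From mathcomp Require Import ring.
Set Implicit Arguments.
Unset Strict Implicit.
Unset Printing Implicit Defensive.
Import Order.TTheory GRing.Theory Num.Theory.
Local Open Scope ring_scope.
Local Open Scope complex_scope.

(** * Totients and radicals *)

Lemma totient_prod (C : numFieldType) (n : nat) : (0 < n)%N ->
  (totient n)%:R / n%:R = \prod_(p <- primes n) (1 - p%:R^-1) :> C.
Proof.
move=> n0; rewrite totientE // [X in _ / X%:R](prod_prime_decomp n0) prime_decompE big_map /=.
rewrite !natr_prod -prodfV -big_split /=; apply: eq_big_seq => p pP.
have /andP[pp e0] : prime p && (0 < logn p n)%N.
  by rewrite logn_gt0 pP andbT; move: pP; rewrite mem_primes => /andP[].
have p0 : p%:R != 0 :> C by rewrite pnatr_eq0 -lt0n prime_gt0.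
rewrite -{2}(prednK e0) expnS !natrM invfM mulrACA mulfV ?mulr1; last first.
  by rewrite natrX expf_neq0.
by rewrite -subn1 natrB ?prime_gt0 // mulrBl mulfV // mul1r.
Qed.

Lemma prod_primes_gt0 (s : seq nat) : all prime s -> (0 < \prod_(p <- s) p)%N.
Proof.
elim: s => [|p s IHs] /=; first by rewrite big_nil.
by move=> /andP[/prime_gt0 p0 /IHs]; rewrite big_cons muln_gt0 p0.
Qed.

(** Holds because [primes n] has no repetitions. This squarefreeness later keeps each p_i from
    dividing k. *)
Lemma logn_radn (p n : nat) : (logn p (radn n) <= 1)%N.
Proof.
rewrite /radn; move: (primes_uniq n) (all_prime_primes n).
elim: (primes n) => [|q s IHs] /=; first by rewrite big_nil logn1.
move=> /andP[qs us] /andP[qP sP]; rewrite big_cons lognM ?prod_primes_gt0 ?prime_gt0 //.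
rewrite (logn_prime _ qP); have [->|_] := eqVneq p q; last exact: IHs.
suff -> : logn q (\prod_(j <- s) j) = 0%N by [].
elim: s qs {us IHs} sP => [|r s IHs] /=; first by rewrite big_nil logn1.
rewrite inE negb_or => /andP[qr qs] /andP[rP sP].
rewrite big_cons lognM ?prod_primes_gt0 ?prime_gt0 //.
by rewrite (logn_prime _ rP) (negPf qr) IHs.
Qed.

Lemma dvdn_radn (p n : nat) : prime p -> (0 < n)%N ->
  (p %| radn n)%N = (p %| n)%N.
Proof.
move=> pP n0; rewrite /radn Euclid_dvd_prod // big_has; apply/hasP/idP.
  move=> [q]; rewrite mem_primes => /and3P[qP _ qn] /=.
  by rewrite (dvdn_prime2 pP qP) => /eqP->.
by move=> pn; exists p => //=; rewrite mem_primes pP n0.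
Qed.

(** * Combinations of nontrivial characters *)

Definition is_char (C : numClosedFieldType) (gT : finGroupType)
    (chi : gT -> C) : Prop :=
  chi 1%g = 1 /\ {morph chi : x y / (x * y)%g >-> x * y}.

(* [hull m f B]: [f] is a linear combination of nontrivial characters whose
   [m]-th power is trivial, with coefficients of total absolute value [B]. *)
Inductive hull (C : numClosedFieldType) (gT : finGroupType) (m : nat) :
    (gT -> C) -> C -> Prop :=
| hull_char (c : C) chi : is_char chi -> (forall x, chi x ^+ m = 1) ->
    (exists x, chi x != 1) -> hull m (fun x => c * chi x) `|c|
| hull0 : hull m (fun=> 0) 0
| hullD f g a b : hull m f a -> hull m g b ->
    hull m (fun x => f x + g x) (a + b)
| hull_ext f g a b : f =1 g -> a = b -> hull m f a -> hull m g b.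

Lemma hull_bound (C : numClosedFieldType) (gT : finGroupType) (A : {set gT})
    (K : C) (m : nat) (f : gT -> C) (B : C) :
  (forall chi : gT -> C, is_char chi -> (exists x, chi x != 1) ->
     `|\sum_(g in A) chi g| <= K) ->
  hull m f B -> `|\sum_(g in A) f g| <= B * K.
Proof.
move=> hK; elim=> [c chi chiC _ chi1||{}f g a b _ IHf _ IHg|{}f g a b fg <- _ IHf].
- by rewrite -mulr_sumr normrM ler_wpM2l //; exact: hK.
- by rewrite big1 // normr0 mul0r.
- by rewrite big_split mulrDl (le_trans (ler_normD _ _)) // lerD.
- by under eq_bigr do rewrite -fg.
Qed.

Lemma hullZ (C : numClosedFieldType) (gT : finGroupType) (m : nat) (c : C)
    (f : gT -> C) (B : C) : hull m f B -> hull m (fun x => c * f x) (`|c| * B).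
Proof.
elim=> [d chi chiC chim chi1||{}f g a b _ IHf _ IHg|{}f g a b fg <- _ IHf].
- apply: hull_ext (hull_char (c * d) chiC chim chi1) => [x|]; first by rewrite mulrA.
  by rewrite normrM.
- by apply: hull_ext (hull0 _ _ _) => [x|]; rewrite mulr0.
- by apply: hull_ext (hullD IHf IHg) => [x|]; rewrite mulrDr.
- by apply: hull_ext IHf => // x; rewrite fg.
Qed.

Lemma hull_sum (C : numClosedFieldType) (gT : finGroupType) (m : nat) (I : Type)
    (s : seq I) (P : pred I) (f : I -> gT -> C) (B : I -> C) :
  (forall i, P i -> hull m (f i) (B i)) ->
  hull m (fun x => \sum_(i <- s | P i) f i x) (\sum_(i <- s | P i) B i).
Proof.
move=> hf; elim: s => [|i s IHs].
  by apply: hull_ext (hull0 _ _ _) => [x|]; rewrite big_nil.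
case: (boolP (P i)) => Pi; last first.
  by apply: hull_ext IHs => [x|]; rewrite big_cons (negPf Pi).
by apply: hull_ext (hullD (hf _ Pi) IHs) => [x|]; rewrite big_cons Pi.
Qed.

Lemma hull_dvd (C : numClosedFieldType) (gT : finGroupType) (m n : nat)
    (f : gT -> C) (B : C) : (m %| n)%N -> hull m f B -> hull n f B.
Proof.
move=> /dvdnP[k ->].
elim=> [d chi chiC chim chi1||{}f g a b _ IHf _ IHg|{}f g a b fg <- _ IHf].
- by apply: hull_char => // x; rewrite mulnC exprM chim expr1n.
- exact: hull0.
- exact: hullD.
- exact: hull_ext IHf.
Qed.

(** The order of [a] divides both [m] and [n], hence their gcd. *)
Lemma coprime_expr_eq1 (C : numClosedFieldType) (m n : nat) (a : C) :
  (0 < m)%N -> coprime m n -> a ^+ m = 1 -> a ^+ n = 1 -> a = 1.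
Proof.
move=> m0 mn am an; have [d dP dm] := prim_order_exists m0 am.
have dn : (d %| n)%N by rewrite (prim_order_dvd dP) an.
have : (d %| gcdn m n)%N by rewrite dvdn_gcd dm.
by rewrite (eqP mn) (prim_order_dvd dP) => /eqP; rewrite expr1.
Qed.

(* Coprimality keeps the products of two nontrivial characters nontrivial. *)
Lemma hullM (C : numClosedFieldType) (gT : finGroupType) (m n : nat)
    (f g : gT -> C) (a b : C) : (0 < m)%N -> coprime m n ->
  hull m f a -> hull n g b -> hull (m * n) (fun x => f x * g x) (a * b).
Proof.
move=> m0 mn hf hg.
elim: hf => [c chi [chi1 chiM] chim [x0 chix0]||{}f f' {}a a' _ IHf _ IHf'
            |{}f f' {}a a' ff' <- _ IHf].
- elim: hg => [d psi [psi1 psiM] psin _||{}g g' {}b b' _ IHg _ IHg'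
            |{}g g' {}b b' gg' <- _ IHg].
  + have := @hull_char _ gT (m * n) (c * d) (fun x => chi x * psi x).
    move=> H; apply: hull_ext (H _ _ _) => [x||||].
    * by rewrite mulrACA.
    * by rewrite normrM.
    * split=> [|x y]; first by rewrite chi1 psi1 mulr1.
      by rewrite chiM psiM mulrACA.
    * by move=> x; rewrite exprMn exprM chim mulnC exprM psin !expr1n mulr1.
    (* Raising [chi x0 * psi x0 = 1] to the power [n] removes [psi], so [chi x0] is killed by both
       [m] and [n]. *)
    * exists x0; apply: contra chix0 => /eqP xpsi.
      apply/eqP/(coprime_expr_eq1 m0 mn) => //.
      by have := congr1 (fun z => z ^+ n) xpsi; rewrite exprMn psin mulr1 expr1n.
  + by apply: hull_ext (hull0 _ _ _) => [x|]; rewrite mulr0.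
  + by apply: hull_ext (hullD IHg IHg') => [x|]; rewrite mulrDr.
  + by apply: hull_ext IHg => // x; rewrite gg'.
- by apply: hull_ext (hull0 _ _ _) => [x|]; rewrite mul0r.
- by apply: hull_ext (hullD IHf IHf') => [x|]; rewrite mulrDl.
- by apply: hull_ext IHf => // x; rewrite ff'.
Qed.

(** * Roots of unity of prime order *)

(** Any root of 1 + X + ... + X^(p-1) will do: this polynomial takes the value p, which is nonzero,
    at 1. *)
Lemma prime_root1_exists (C : numClosedFieldType) (p : nat) : prime p ->
  exists2 z : C, z != 1 & z ^+ p = 1.
Proof.
move=> pP; have /closed_rootP[z] : size (\poly_(i < p) 1 : {poly C}) != 1%N.
  by rewrite size_poly_eq ?oner_eq0 // neq_ltn prime_gt1 ?orbT.
rewrite /root horner_poly => /eqP z0; exists z.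
  apply/eqP => z1; move: z0; rewrite z1.
  under eq_bigr do rewrite mul1r expr1n.
  rewrite sumr_const card_ord => /eqP; rewrite pnatr_eq0 => /eqP p0.
  by rewrite p0 in pP.
apply/eqP; rewrite -subr_eq0 subrX1.
by under eq_bigr do rewrite -[_ ^+ _]mul1r; rewrite z0 mulr0.
Qed.

Lemma prime_expr_eq1 (C : numClosedFieldType) (p a : nat) (z : C) : prime p ->
  z != 1 -> z ^+ p = 1 -> (z ^+ a == 1) = (p %| a)%N.
Proof.
move=> pP z1 zp; apply/idP/idP => [/eqP za|/dvdnP[b ->]]; last first.
  by rewrite mulnC exprM zp expr1n.
apply: contraR z1; rewrite -prime_coprime // => pa.
by apply/eqP/(coprime_expr_eq1 (prime_gt0 pP) pa).
Qed.

(** * The sieve in a cyclic group *)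

Section Sieve.

Variables (C : numClosedFieldType) (gT : finGroupType) (g0 : gT).
Variable dlog : gT -> nat.
Hypothesis dlogK : forall x, (g0 ^+ dlog x)%g = x.

Local Notation N := #[g0]%g.

(** [dlog] is additive only modulo [N], which is enough when [z ^+ N = 1]. *)
Lemma dlog_char (z : C) : z ^+ N = 1 -> is_char (fun x => z ^+ dlog x).
Proof.
have zE a b : z ^+ N = 1 -> (g0 ^+ a = g0 ^+ b)%g -> z ^+ a = z ^+ b.
  move=> zN /eqP; rewrite eq_expg_mod_order => /eqP ab.
  by rewrite -(expr_mod a zN) ab expr_mod.
move=> zN; split=> [|x y]; first by rewrite -(expr0 z); apply: zE; rewrite ?dlogK.
by rewrite -exprD; apply: zE; rewrite // expgD !dlogK.
Qed.

(** For [p] dividing [N] this is the indicator of the p-th powers. *)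
Definition pow_ind (p : nat) (x : gT) : C := (p %| dlog x)%:R.

(** Orthogonality: the indicator is the average of the p characters sending x to z^(i dlog x), for i
    < p. The term i = 0 is the constant 1/p; the p - 1 others are nontrivial with coefficient 1/p
    each. *)
Lemma hull_pow_ind (p : nat) : prime p -> (p %| N)%N ->
  hull p (fun x => pow_ind p x - p%:R^-1) (1 - p%:R^-1).
Proof.
move=> pP pN; have [z z1 zp] := prime_root1_exists C pP.
have p0 : p%:R != 0 :> C by rewrite pnatr_eq0 -lt0n prime_gt0.
pose h (i : 'I_p) (x : gT) : C := p%:R^-1 * (z ^+ i) ^+ dlog x.
have hh (i : 'I_p) : val i != 0%N -> hull p (h i) `|p%:R^-1|.
  move=> i0; have zi1 : z ^+ i != 1.
    by rewrite (prime_expr_eq1 _ pP z1 zp) gtnNdvd // lt0n.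
  have zip : (z ^+ i) ^+ p = 1 by rewrite exprAC zp expr1n.
  apply: hull_char.
  - by apply: dlog_char; case/dvdnP: pN => b ->; rewrite mulnC exprM zip expr1n.
  - by move=> x; rewrite exprAC zip expr1n.
  - exists g0; rewrite (prime_expr_eq1 _ pP zi1 zip).
    (* The character is nontrivial at [g0], since [dlog g0] is 1 modulo [N], hence modulo [p]. *)
    have /eqP := dlogK g0; rewrite -[X in _ == X]expg1 eq_expg_mod_order => /eqP e.
    have {}e : dlog g0 = 1 %[mod p] by rewrite -(modn_dvdm _ pN) e modn_dvdm.
    by rewrite /dvdn e modn_small ?prime_gt1.
have := hull_sum (index_enum _) hh.
apply: hull_ext => [x|].
  rewrite /h -mulr_sumr; apply: (mulfI p0); rewrite mulVKf // mulrBr mulfV //.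
  have -> : \sum_(i < p | val i != 0%N) (z ^+ i) ^+ dlog x
      = \sum_(i < p) (z ^+ dlog x) ^+ i - 1.
    rewrite [in RHS](bigD1 (Ordinal (prime_gt0 pP))) //= expr0 addrAC subrr add0r.
    by apply: eq_big => // i _; rewrite exprAC.
  congr (_ - 1); rewrite /pow_ind -(prime_expr_eq1 _ pP z1 zp).
  have [->|zx1] := eqVneq (z ^+ dlog x) 1.
    by under eq_bigr do rewrite expr1n; rewrite sumr_const card_ord mulr1.
  have := subrX1 (z ^+ dlog x) p; rewrite exprAC zp expr1n subrr mulr0 => /esym/eqP.
  by rewrite mulf_eq0 subr_eq0 (negPf zx1) => /eqP.
rewrite sumr_const ger0_norm ?invr_ge0 ?ler0n //.
have -> : #|[pred i : 'I_p | val i != 0%N]| = p.-1.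
  have := cardC1 (Ordinal (prime_gt0 pP)); rewrite card_ord => <-.
  by apply: eq_card => i; rewrite !inE.
by rewrite -[LHS]mulr_natr -subn1 natrB ?prime_gt0 // mulrBr mulVf // mulr1.
Qed.

Definition free_ind (s : seq nat) (x : gT) : C := \prod_(p <- s) (1 - pow_ind p x).
Definition rho_prod (s : seq nat) : C := \prod_(p <- s) (1 - p%:R^-1).

Lemma rho_prod_ge0 (s : seq nat) : all prime s -> 0 <= rho_prod s.
Proof.
move=> /allP sP; rewrite /rho_prod big_seq; apply: prodr_ge0 => p /sP pP.
by rewrite subr_ge0 invf_le1 ?ltr0n ?ler1n prime_gt0.
Qed.

Lemma coprime_prod (s : seq nat) (p : nat) : all prime s -> prime p ->
  p \notin s -> coprime (\prod_(q <- s) q) p.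
Proof.
move=> /allP sP pP ps; rewrite coprime_sym prime_coprime // Euclid_dvd_prod // big_has.
apply/hasPn => q qs /=; rewrite (dvdn_prime2 pP (sP _ qs)).
by apply: contra ps => /eqP->.
Qed.

(* Split [free_ind s] into its mean [rho_prod s] and the remainder of size [B];
   [p] being coprime to [s], no trivial character appears in the product. *)
Lemma hull_free_pow (s : seq nat) (p : nat) (B : C) :
  all prime s -> prime p -> (p %| N)%N -> p \notin s ->
  hull (\prod_(q <- s) q) (fun x => free_ind s x - rho_prod s) B ->
  hull ((\prod_(q <- s) q) * p)
    (fun x => free_ind s x * (pow_ind p x - p%:R^-1))
    ((rho_prod s + B) * (1 - p%:R^-1)).
Proof.
move=> sP pP pN ps hs; have hp := hull_pow_ind pP pN.
have P0 := prod_primes_gt0 sP.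
have h1 := hull_dvd (dvdn_mull (\prod_(q <- s) q)%N (dvdnn p)) (hullZ (rho_prod s) hp).
have h2 := hullM P0 (coprime_prod sP pP ps) hs hp.
apply: hull_ext (hullD h1 h2) => [x|]; first by rewrite -mulrDl addrC subrK.
by rewrite ger0_norm ?rho_prod_ge0 // -mulrDl.
Qed.

(** Induction on [s], writing u for [free_ind s], rho for its mean, and e for [pow_ind p]: the new
    difference is (1 - 1/p)(u - rho) - u(e - 1/p). With n = [size s], the sizes add up to (1 - 1/p)
    rho ((2^n - 1) + 2^n). *)
Lemma hull_free (s : seq nat) :
  all prime s -> uniq s -> {in s, forall p, (p %| N)%N} ->
  hull (\prod_(q <- s) q) (fun x => free_ind s x - rho_prod s)
    (rho_prod s * ((2 ^ size s)%:R - 1)).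
Proof.
elim: s => [_ _ _|p s IHs /= /andP[pP sP] /andP[ps us] sN].
  apply: hull_ext (hull0 _ _ _) => [x|].
    by rewrite /free_ind /rho_prod !big_nil subrr.
  by rewrite expn0 subrr mulr0.
have pN : (p %| N)%N by apply: sN; rewrite mem_head.
have {}IHs := IHs sP us (fun q qs => sN q (@mem_behead _ (p :: s) q qs)).
have h1 := hull_free_pow sP pP pN ps IHs.
have h2 := hull_dvd (dvdn_mulr p (dvdnn _)) IHs.
rewrite big_cons mulnC.
apply: hull_ext (hullD (hullZ (1 - p%:R^-1) h2) (hullZ (-1) h1)) => [x|].
  by rewrite /free_ind /rho_prod !big_cons; ring.
have p1 : 0 <= 1 - p%:R^-1 :> C by rewrite subr_ge0 invf_le1 ?ltr0n ?ler1n prime_gt0.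
rewrite (ger0_norm p1) normrN1 /rho_prod big_cons expnS natrM; ring.
Qed.

(** Main term against error term when every discrete logarithm in [A] is divisible by one of the
    sieving primes. The contrapositive yields the primitive element. *)
Lemma sieve_bound (A : {set gT}) (K : C) (s : seq nat) (s1 s2 : nat)
    (p : 'I_s1 -> nat) (l : 'I_s2 -> nat) :
  (forall chi : gT -> C, is_char chi -> (exists x, chi x != 1) ->
     `|\sum_(g in A) chi g| <= K) ->
  all prime s -> uniq s -> {in s, forall p, (p %| N)%N} ->
  (forall i, prime (p i)) -> (forall i, p i %| N)%N -> (forall i, p i \notin s) ->
  (forall j, prime (l j)) -> (forall j, l j %| N)%N ->
  {in A, forall x, (exists2 q, q \in s & q %| dlog x)%N \/
    (exists i, p i %| dlog x)%N \/ (exists j, l j %| dlog x)%N} ->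
  let delta : C := 1 - \sum_(i < s1) (p i)%:R^-1 in
  let eps : C := \sum_(j < s2) (l j)%:R^-1 in
  let rs := rho_prod s in
  0 <= delta ->
  (delta * rs - eps) * #|A|%:R <=
  (rs * (2 ^ size s)%:R * (s1%:R + 2 * delta - 1) + s2%:R - delta * rs - eps) * K.
Proof.
move=> hK sP us sN pP pN ps lP lN hA delta eps rs delta0.
have hs := hull_free sP us sN.
(* Every exponent divides 0, and a zeroth power is always 1: this forgets the exponents, so that all
   terms can be added. *)
have ub m (f : gT -> C) B : hull m f B -> hull 0 f B by apply: hull_dvd; rewrite dvdn0.
have h1 := ub _ _ _ (hullZ delta hs).
have h2i i := ub _ _ _ (hullZ (-1) (hull_free_pow sP (pP i) (pN i) (ps i) hs)).
have h2 := hull_sum (P := xpredT) (index_enum _) (fun i _ => h2i i).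
have h3j j := ub _ _ _ (hullZ (-1) (hull_pow_ind (lP j) (lN j))).
have h3 := hull_sum (P := xpredT) (index_enum _) (fun j _ => h3j j).
move: (hullD h1 (hullD h2 h3)); set H := (X in hull 0 X _); set B := (X in hull 0 _ X).
move=> /(hull_bound hK) HB.
(* The sum of the 1 - 1/p_i is s1 - 1 + delta; the first term of [H] supplies the second delta. *)
have -> : rs * (2 ^ size s)%:R * (s1%:R + 2 * delta - 1) + s2%:R - delta * rs - eps = B.
  rewrite /B (ger0_norm delta0).
  under [\sum_(i < s1) _]eq_bigr do rewrite normrN1 mul1r.
  under [\sum_(i < s2) _]eq_bigr do rewrite normrN1 mul1r.
  rewrite -mulr_sumr !sumrB !sumr_const !card_ord -/eps -/rs /delta; ring.
pose S x := free_ind s x - \sum_(i < s1) free_ind s x * pow_ind (p i) x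
             - \sum_(j < s2) pow_ind (l j) x.
have SE x : S x = H x + (delta * rs - eps).
  rewrite /S /H -!mulr_sumr !sumrB -/eps -/rs /delta; ring.
have ind01 q x : 0 <= pow_ind q x <= 1 by rewrite ler0n lern1 leq_b1.
have free0 x : 0 <= free_ind s x.
  by apply: prodr_ge0 => q _; rewrite subr_ge0; case/andP: (ind01 q x).
(* A prime of [s] makes [free_ind] vanish; some p_i makes the first sum at least [free_ind]; some
   l_j makes the second sum at least 1, which bounds [free_ind]. *)
have S_le0 x : x \in A -> S x <= 0.
  move=> xA; rewrite /S.
  have l0 : 0 <= \sum_(j < s2) pow_ind (l j) x.
    by apply: sumr_ge0 => j _; case/andP: (ind01 (l j) x).
  have p0 : 0 <= \sum_(i < s1) pow_ind (p i) x.
    by apply: sumr_ge0 => j _; case/andP: (ind01 (p j) x).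
  rewrite -mulr_sumr.
  have [[q qs qx]|[[i ix]|[j jx]]] := hA x xA.
  - have -> : free_ind s x = 0.
      by rewrite /free_ind (big_rem q qs) /= /pow_ind qx subrr mul0r.
    by rewrite mul0r subr0 sub0r oppr_le0.
  - have p1 : 1 <= \sum_(i < s1) pow_ind (p i) x.
      rewrite (bigD1 i) //= {1}/pow_ind ix lerDl; apply: sumr_ge0 => j _.
      by case/andP: (ind01 (p j) x).
    by rewrite subr_le0 (le_trans _ l0) // subr_le0 ler_peMr.
  - have l1 : 1 <= \sum_(j < s2) pow_ind (l j) x.
      rewrite (bigD1 j) //= {1}/pow_ind jx lerDl; apply: sumr_ge0 => j' _.
      by case/andP: (ind01 (l j') x).
    rewrite subr_le0 (le_trans _ l1) // lerBlDr.
    apply: (@le_trans _ _ 1); last by rewrite lerDl mulr_ge0.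
    rewrite /free_ind; elim: (s) => [|q t IHt]; first by rewrite big_nil.
    rewrite big_cons mulr_ile1 //; last by rewrite gerBl; case/andP: (ind01 q x).
      by rewrite subr_ge0; case/andP: (ind01 q x).
    by apply: prodr_ge0 => q' _; rewrite subr_ge0; case/andP: (ind01 q' x).
have AH : (delta * rs - eps) * #|A|%:R <= - \sum_(g in A) H g.
  have : \sum_(g in A) S g <= 0 by apply: sumr_le0.
  under eq_bigr do rewrite SE.
  by rewrite big_split sumr_const /= -lerBrDl sub0r mulr_natr.
(* The order on [C] is partial, and bounding a value by its norm requires it to be real;
   comparability with the real left side of [AH] ensures this. *)
have Hreal : - \sum_(g in A) H g \is Num.real.
  rewrite -(ler_real AH) realM ?realn // realB ?realM ?ger0_real ?rho_prod_ge0 //.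
  by apply: sumr_ge0 => j _; rewrite invr_ge0 ler0n.
by rewrite (le_trans AH) // (le_trans (real_ler_norm Hreal)) // normrN.
Qed.

End Sieve.

(** * Application to the unit group of the field *)

(** Take the least positive exponent [d] killing [chi]; a nonzero remainder of the group order
    modulo [d] would be a smaller one. This makes the bound assumed order by order apply to every
    nontrivial character. *)
Lemma char_order_exists (R : realType) (F : finFieldType) (chi : {unit F} -> R[i]) :
  mult_char chi -> (exists x, chi x != 1) ->
  exists d, [/\ (1 < d)%N, (d %| #|[set: {unit F}]|)%N & char_order chi d].
Proof.
move=> [chi1 chiM] [x0 chix0]; set N := #|_|.
have chiX x n : chi (x ^+ n)%g = chi x ^+ n.
  by elim: n => [|n IHn]; rewrite ?expg0 ?expr0 // expgS exprS chiM IHn.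
have chiN x : chi x ^+ N = 1 by rewrite -chiX expg_cardG ?inE.
have ex : exists d, (0 < d)%N && [forall x, chi x ^+ d == 1].
  by exists N; rewrite cardG_gt0; apply/forallP => x; rewrite chiN.
case: (ex_minnP ex) => d /andP[d0 /forallP chid] dmin.
have dle m : (0 < m)%N -> (forall x, chi x ^+ m = 1) -> (d <= m)%N.
  by move=> m0 hm; apply: dmin; rewrite m0; apply/forallP => x; rewrite hm.
exists d; split; last by split=> // x; apply/eqP.
  rewrite ltn_neqAle d0 andbT; apply: contra chix0 => /eqP d1.
  by rewrite -(expr1 (chi x0)) d1.
rewrite /dvdn -leqn0 leqNgt; apply/negP => Nd.
have := dle _ Nd; rewrite leqNgt ltn_mod d0 => H; suff: false by [].
by apply: H => x; rewrite expr_mod //; apply/eqP.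
Qed.

Theorem theorem1 (R : realType) (q r : nat) (F : finFieldType)
    (hq : prime_power q) (hr : (2 <= r)%N) (hF : #|F| = (q ^ r)%N)
    (A : {set {unit F}}) (K : R) (hK : 0 <= K)
    (hA : forall d : nat, (1 < d)%N -> (d %| q ^ r - 1)%N ->
       forall chi : {unit F} -> R[i], mult_char chi -> char_order chi d ->
         `|\sum_(g in A) chi g| <= K%:C)
    (k s1 s2 : nat) (p : 'I_s1 -> nat) (l : 'I_s2 -> nat)
    (hk : (0 < k)%N) (hp : forall i, prime (p i)) (hl : forall j, prime (l j))
    (hrad : radn (q ^ r - 1)%N =
       (k * (\prod_(i < s1) p i) * (\prod_(j < s2) l j))%N)
    (delta eps : R)
    (hdelta : delta = 1 - \sum_(i < s1) (p i)%:R^-1)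
    (heps : eps = \sum_(j < s2) (l j)%:R^-1)
    (hpos : eps < delta * rho R k)
    (hcard : (rho R k * (W k)%:R * (s1%:R + 2 * delta - 1)
                + s2%:R - delta * rho R k - eps)
             / (delta * rho R k - eps) * K < #|A|%:R) :
  exists2 g : {unit F}, g \in A & generator [set: {unit F}] g.

Proof.
pose N := #|[set: {unit F}]|.
have NE : (q ^ r - 1)%N = N by rewrite -hF subn1 /N card_finField_unit.
have N0 : (0 < N)%N by rewrite cardG_gt0.
rewrite NE in hA hrad.
have /cyclicP[g0 g0E] := field_unit_group_cyclic [set: {unit F}]%G.
have g0N : #[g0]%g = N by rewrite /N /= g0E.
have dlogP x : exists n, (g0 ^+ n)%g == x.
  have : x \in <[g0]>%g by rewrite -g0E inE.
  by case/cycleP => n ->; exists n.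
pose dlog x := xchoose (dlogP x).
have dlogK x : (g0 ^+ dlog x)%g = x by apply/eqP/(xchooseP (dlogP x)).
have genE x : generator [set: {unit F}] x = coprime N (dlog x).
  by rewrite -{1}(dlogK x) g0E generator_coprime g0N.
case: (pickP [pred g in A | generator [set: {unit F}] g]) => [g /andP[gA gG]|nogen].
  by exists g.
have hK' (chi : {unit F} -> R[i]) : is_char chi -> (exists x, chi x != 1) ->
    `|\sum_(g in A) chi g| <= K%:C.
  move=> chiC chi1; have [d [d1 dN hd]] := char_order_exists chiC chi1.
  exact: hA d1 dN chi chiC hd.
have dvd_rad x : prime x -> (x %| k * \prod_(i < s1) p i * \prod_(j < s2) l j)%N =
    (x %| N)%N.
  by move=> xP; rewrite -hrad dvdn_radn.
have kN : {in primes k, forall x, (x %| #[g0]%g)%N}.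
  move=> x; rewrite mem_primes g0N => /and3P[xP _ xk].
  by rewrite -dvd_rad // -mulnA dvdn_mulr.
have pN i : (p i %| #[g0]%g)%N.
  by rewrite g0N -dvd_rad // mulnAC dvdn_mull // (bigD1 i) //= dvdn_mulr.
have lN j : (l j %| #[g0]%g)%N.
  by rewrite g0N -dvd_rad // dvdn_mull // (bigD1 j) //= dvdn_mulr.
(* Otherwise the square of p_i would divide the radical. *)
have pk i : p i \notin primes k.
  apply/negP; rewrite mem_primes => /and3P[_ _ pik].
  have := logn_radn (p i) N; rewrite leqNgt => /negP; apply.
  rewrite -pfactor_dvdn ?hp //; last first.
    by rewrite /radn prod_primes_gt0 ?all_prime_primes.
  by rewrite hrad dvdn_mulr // expnS expn1 dvdn_mul // (bigD1 i) //= dvdn_mulr.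
have hA' : {in A, forall x, (exists2 y, y \in primes k & y %| dlog x)%N \/
    (exists i, p i %| dlog x)%N \/ (exists j, l j %| dlog x)%N}.
  move=> x xA; have := nogen x; rewrite /= xA genE /= => nc.
  (* A non-generator has a logarithm sharing a prime with [N]; this prime divides the radical, hence
     one of its given factors. *)
  have g1 : (1 < gcdn N (dlog x))%N.
    by rewrite ltn_neqAle eq_sym -[_ == 1%N]/(coprime _ _) nc gcdn_gt0 N0.
  have := pdiv_dvd (gcdn N (dlog x)); rewrite dvdn_gcd => /andP[].
  have := pdiv_prime g1; set y := pdiv _ => yP yN yx.
  move: yN; rewrite -dvd_rad // !Euclid_dvdM // -orbA => /or3P[yk|yp|yl].
  - by left; exists y; rewrite // mem_primes yP hk.
  - move: yp; rewrite Euclid_dvd_prod // big_has => /hasP[i _].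
    by rewrite (dvdn_prime2 yP (hp i)) => /eqP yi; right; left; exists i; rewrite -yi.
  - move: yl; rewrite Euclid_dvd_prod // big_has => /hasP[j _].
    by rewrite (dvdn_prime2 yP (hl j)) => /eqP yj; right; right; exists j; rewrite -yj.
have rho0 : 0 < rho R k by rewrite divr_gt0 ?ltr0n ?totient_gt0.
have eps0 : 0 <= eps by rewrite heps sumr_ge0 // => j _; rewrite invr_ge0 ler0n.
(* Forced by delta rho(k) > eps >= 0 and rho(k) > 0. *)
have delta0 : 0 <= delta.
  by rewrite -(pmulr_lge0 _ rho0) ltW // (le_lt_trans eps0).
(* The sieve inequality lives in [R[i]]; its real quantities are now pulled back to [R]. *)
have deltaC : 1 - \sum_(i < s1) (p i)%:R^-1 = delta%:C.
  rewrite hdelta rmorphB rmorph1 rmorph_sum; congr (_ - _).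
  by apply: eq_bigr => i _; rewrite fmorphV rmorph_nat.
have epsC : \sum_(j < s2) (l j)%:R^-1 = eps%:C.
  by rewrite heps rmorph_sum; apply: eq_bigr => i _; rewrite fmorphV rmorph_nat.
have rhoC : rho_prod R[i] (primes k) = (rho R k)%:C.
  by rewrite /rho_prod -totient_prod // /rho fmorph_div !rmorph_nat.
have := sieve_bound dlogK hK' (all_prime_primes k) (primes_uniq k) kN hp pN pk hl lN hA'.
rewrite /= deltaC epsC rhoC lecR => /(_ delta0).
have -> : (delta%:C * (rho R k)%:C - eps%:C) * #|A|%:R =
    ((delta * rho R k - eps) * #|A|%:R)%:C.
  by rewrite !(rmorphM, rmorphB, rmorph_nat).
have -> : ((rho R k)%:C * (2 ^ size (primes k))%:R * (s1%:R + 2 * delta%:C - 1) + s2%:R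
     - delta%:C * (rho R k)%:C - eps%:C) * K%:C =
   ((rho R k * (W k)%:R * (s1%:R + 2 * delta - 1) + s2%:R - delta * rho R k - eps) * K)%:C.
  by rewrite !(rmorphM, rmorphB, rmorphD, rmorph_nat, rmorph1).
rewrite lecR leNgt => /negP[].
by move: hcard; rewrite mulrAC ltr_pdivrMr ?subr_gt0 // [ltRHS]mulrC.
Qed.
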